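(* Let $F$ be Thompson's group $F$, regarded as a discrete group. Then $F$ is not strongly amenable; that is, there exist a nonempty compact Hausdorff space $X$ and a continuous action of $F$ on $X$ that is proximal and has no fixed point (no $x\in X$ with $fx=x$ for all $f\in F$).
   Context: Thompson's group $F$ is represented as the group of piecewise linear homeomorphisms of $\mathbb{R}$ (under composition) generated by $$a(x)=x-1,\qquad b(x)=\begin{cases} x & x\le 0\\ x/2 & 0\le x\le 2\\ x-1 & 2\le x.\end{cases}$$ A continuous action of a topological group $G$ on a compact Hausdorff space $X$ is proximal if for every $x,y\in X$ there exists a net $\{g_i\}$ of elements of $G$ such that $\lim_i g_i x$ and $\lim_i g_i y$ exist and are equal. A group is strongly amenable if each of its proximal actions on a (nonempty) compact Hausdorff space has a fixed point. *)

(* Defs.v *)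
From HB Require Import structures.
From mathcomp Require Import all_boot all_order all_algebra.
From mathcomp Require Import all_classical all_reals all_analysis.
From mathcomp Require Import lra.

Set Implicit Arguments.
Unset Strict Implicit.
Unset Printing Implicit Defensive.

Import Order.TTheory GRing.Theory Num.Theory.
Import numFieldNormedType.Exports.

Local Open Scope classical_set_scope.
Local Open Scope ring_scope.

HB.mixin Record isTopologicalGroup G of Group G & Topological G := {
  mulg_continuous : continuous (fun p : G * G => (p.1 * p.2)%g) ;
  invg_continuous : continuous (fun x : G => (x^-1)%g)
}.

#[short(type="topologicalGroupType")]
HB.structure Definition TopologicalGroup :=
  {G of isTopologicalGroup G & Group G & Topological G}.

Section DiscreteGroup.
Variable G : groupType.

HB.instance Definition _ := Group.copy (discrete_topology G) G.

Let discrete_mulg_continuous : continuous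
  (fun p : discrete_topology G * discrete_topology G => (p.1 * p.2)%g).
Proof.
move=> [x y] U /= /nbhs_singleton Uxy.
exists ([set x], [set y]); first by split; exact: discrete_set1.
by move=> [x' y'] [/= -> ->].
Qed.

Let discrete_invg_continuous :
  continuous (fun x : discrete_topology G => (x^-1)%g).
Proof.
move=> x U /nbhs_singleton Ux.
by apply: (filterS _ (discrete_set1 x)) => _ ->.
Qed.

HB.instance Definition _ := isTopologicalGroup.Build (discrete_topology G)
  discrete_mulg_continuous discrete_invg_continuous.

End DiscreteGroup.

Definition group_action (G : groupType) (X : Type) (act : G -> X -> X) : Prop :=
  (forall x, act 1%g x = x) /\
  (forall g h x, act (g * h)%g x = act g (act h x)).

(* For discrete G, joint continuity amounts to continuity of each [act g]. *)
Definition continuous_action (G : topologicalGroupType) (X : topologicalType)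
    (act : G -> X -> X) : Prop :=
  group_action act /\ continuous (fun p : G * X => act p.1 p.2).

Definition directed_preorder (I : Type) (le : I -> I -> Prop) : Prop :=
  [/\ inhabited I,
      (forall i, le i i),
      (forall i j k, le i j -> le j k -> le i k) &
      (forall i j, exists k, le i k /\ le j k)].

(* A net u : I -> X converges to z iff [u i @[i --> net_tails le] --> z]. *)
Definition net_tails (I : Type) (le : I -> I -> Prop) : set_system I :=
  filter_from [set: I] (fun i => [set j | le i j]).

Definition proximal (G : groupType) (X : topologicalType)
    (act : G -> X -> X) : Prop :=
  forall x y : X,
    exists (I : Type) (le : I -> I -> Prop) (g : I -> G) (z : X),
      [/\ directed_preorder le,
          act (g i) x @[i --> net_tails le] --> z &
          act (g i) y @[i --> net_tails le] --> z].

Definition has_fixed_point (G : groupType) (X : Type)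
    (act : G -> X -> X) : Prop :=
  exists x : X, forall g : G, act g x = x.

Definition strongly_amenable (G : topologicalGroupType) : Prop :=
  forall (X : topologicalType) (act : G -> X -> X),
    [set: X] !=set0 -> compact [set: X] -> hausdorff_space X ->
    continuous_action act -> proximal act -> has_fixed_point act.

Record homeo (T : topologicalType) := Homeo {
  homeo_fun :> T -> T ;
  homeo_inv : T -> T ;
  homeo_continuous : continuous homeo_fun ;
  homeo_inv_continuous : continuous homeo_inv ;
  homeoK : cancel homeo_fun homeo_inv ;
  homeoVK : cancel homeo_inv homeo_fun
}.

Section HomeoGroup.
Variable T : topologicalType.
Implicit Types f g h : homeo T.

Lemma homeo_ext f g : f =1 g -> f = g.
Proof.
case: f g => [f f' cf cf' fK f'K] [g g' cg cg' gK g'K] /= /funext efg.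
subst g.
have efg' : f' = g' by apply/funext => x; rewrite -[x in LHS]g'K fK.
subst g'.
by congr Homeo; exact: Prop_irrelevance.
Qed.

HB.instance Definition _ := gen_eqMixin (homeo T).
HB.instance Definition _ := gen_choiceMixin (homeo T).

Definition homeo_one : homeo T :=
  @Homeo T idfun idfun (fun x => cvg_id) (fun x => cvg_id)
    (fun=> erefl) (fun=> erefl).

Lemma comp_homeo_continuous f g : continuous (f \o g).
Proof.
by move=> x; apply: continuous_comp; exact: homeo_continuous.
Qed.

Lemma comp_homeo_inv_continuous f g :
  continuous (homeo_inv g \o homeo_inv f).
Proof.
by move=> x; apply: continuous_comp; exact: homeo_inv_continuous.
Qed.

Definition homeo_comp f g : homeo T :=
  Homeo (@comp_homeo_continuous f g) (@comp_homeo_inv_continuous f g)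
    (can_comp (@homeoK T f) (@homeoK T g))
    (can_comp (@homeoVK T g) (@homeoVK T f)).

Definition homeo_sym f : homeo T :=
  Homeo (@homeo_inv_continuous T f) (@homeo_continuous T f)
    (@homeoVK T f) (@homeoK T f).

Let homeo_compA : associative homeo_comp.
Proof. by move=> f g h; exact: homeo_ext. Qed.
Let homeo_comp1h : left_id homeo_one homeo_comp.
Proof. by move=> f; exact: homeo_ext. Qed.
Let homeo_comph1 : right_id homeo_one homeo_comp.
Proof. by move=> f; exact: homeo_ext. Qed.
Let homeo_compVh : left_inverse homeo_one homeo_sym homeo_comp.
Proof. by move=> f; apply: homeo_ext => x /=; exact: homeoK. Qed.
Let homeo_comphV : right_inverse homeo_one homeo_sym homeo_comp.
Proof. by move=> f; apply: homeo_ext => x /=; exact: homeoVK. Qed.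

HB.instance Definition _ := isGroup.Build (homeo T)
  homeo_compA homeo_comp1h homeo_comph1 homeo_compVh homeo_comphV.

End HomeoGroup.

Definition subgroup (G : groupType) (H : set G) : Prop :=
  [/\ H 1%g, (forall x y, H x -> H y -> H (x * y)%g) &
      (forall x, H x -> H (x^-1)%g)].

Definition generated_subgroup (G : groupType) (A : set G) : set G :=
  smallest (@subgroup G) A.

Section GeneratedSubgroup.
Variables (G : groupType) (A : set G).

Lemma generated_subgroupP : subgroup (generated_subgroup A).
Proof.
split=> [H [[]] //|x y Hx Hy H HA|x Hx H HA].
  by have [[_ HM _] _] := HA; apply: HM; [exact: Hx|exact: Hy].
by have [[_ _ HV] _] := HA; apply: HV; exact: Hx.
Qed.

Let in_generated_subgroup : pred G := fun x => x \in generated_subgroup A.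

Let generated_group_closed : group_closed in_generated_subgroup.
Proof.
have [H1 HM HV] := generated_subgroupP.
split=> [|x y]; first exact/mem_set.
by move=> /set_mem Hx /set_mem Hy; apply/mem_set; apply: HM Hx _; exact: HV.
Qed.

Definition generated_group : Type := {x : G | x \in generated_subgroup A}.

HB.instance Definition _ := SubChoice.on generated_group.

HB.instance Definition _ := SubChoice_isSubGroup.Build G
  in_generated_subgroup generated_group generated_group_closed.

End GeneratedSubgroup.

Section Thompson.
Variable R : realType.
Implicit Types x : R.

Definition thompson_a x : R := x - 1.

Definition thompson_b x : R :=
  if x <= 0 then x else if x <= 2 then x / 2 else x - 1.

Definition thompson_a_inv x : R := x + 1.

Definition thompson_b_inv x : R :=
  if x <= 0 then x else if x <= 1 then x * 2 else x + 1.

Lemma thompson_a_continuous : continuous thompson_a.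
Proof. by move=> x; apply: cvgB; [exact: cvg_id|exact: cvg_cst]. Qed.

Lemma thompson_a_inv_continuous : continuous thompson_a_inv.
Proof. by move=> x; apply: cvgD; [exact: cvg_id|exact: cvg_cst]. Qed.

Lemma thompson_b_continuous : continuous thompson_b.
Proof.
have -> : thompson_b =
    (fun x => Num.max (Num.min x (x / 2)) (x - 1)).
  apply/funext => x; rewrite /thompson_b /Num.max /Num.min.
  by repeat case: ifPn; rewrite -?ltNge -?leNgt => *; lra.
move=> x; apply: (@continuous_max R _ (fun x => Num.min x (x / 2))).
  apply: (@continuous_min R _ id); first exact: cvg_id.
  by apply: cvgM; [exact: cvg_id|exact: cvg_cst].
exact: thompson_a_continuous.
Qed.

Lemma thompson_b_inv_continuous : continuous thompson_b_inv.
Proof.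
have -> : thompson_b_inv =
    (fun x => Num.min (Num.max x (x * 2)) (x + 1)).
  apply/funext => x; rewrite /thompson_b_inv /Num.max /Num.min.
  by repeat case: ifPn; rewrite -?ltNge -?leNgt => *; lra.
move=> x; apply: (@continuous_min R _ (fun x => Num.max x (x * 2))).
  apply: (@continuous_max R _ id); first exact: cvg_id.
  by apply: cvgM; [exact: cvg_id|exact: cvg_cst].
exact: thompson_a_inv_continuous.
Qed.

Lemma thompson_aK : cancel thompson_a thompson_a_inv.
Proof. by move=> x; exact: subrK. Qed.

Lemma thompson_aVK : cancel thompson_a_inv thompson_a.
Proof. by move=> x; exact: addrK. Qed.

Lemma thompson_bK : cancel thompson_b thompson_b_inv.
Proof.
move=> x; rewrite /thompson_b /thompson_b_inv.
by repeat case: ifPn; rewrite -?ltNge -?leNgt => *; lra.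
Qed.

Lemma thompson_bVK : cancel thompson_b_inv thompson_b.
Proof.
move=> x; rewrite /thompson_b /thompson_b_inv.
by repeat case: ifPn; rewrite -?ltNge -?leNgt => *; lra.
Qed.

Definition homeo_a : homeo R :=
  Homeo thompson_a_continuous thompson_a_inv_continuous
    thompson_aK thompson_aVK.

Definition homeo_b : homeo R :=
  Homeo thompson_b_continuous thompson_b_inv_continuous
    thompson_bK thompson_bVK.

Definition thompsonF : groupType :=
  generated_group [set homeo_a; homeo_b].

End Thompson.

(* Main.v *)
Require Import Defs.
From mathcomp Require Import all_boot all_order all_algebra.
From mathcomp Require Import all_classical all_reals all_analysis.
From mathcomp Require Import zify ring lra.

Set Implicit Arguments.
Unset Strict Implicit.
Unset Printing Implicit Defensive.

Import Order.TTheory GRing.Theory Num.Theory.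
Import numFieldNormedType.Exports.

Local Open Scope classical_set_scope.
Local Open Scope ring_scope.

(** [F] acts on the dyadic rationals [D]; for [g] in [F] and [t] in [D] let
  [c g t] be the parity of the integer [k] such that [2 ^ k] is the slope of
  [g] on the right of [t].  The chain rule makes [c] a cocycle, so [F] acts on
  the functions [u : D -> {1, -1}] by
    [(g u) t = (-1) ^ (c g (g^-1 t)) * u (g^-1 t)],
  and on the compact space [X] of such functions up to a global sign.

  - No point of [X] is fixed ([twisted_act_no_fixed_point]).  If [u] is fixed
    up to sign by [g] and [g] fixes [s] and [t], then the sign is both [c g s]
    and [c g t].  But [b] fixes [0], where its right slope is 1/2, and [-1],
    where its slope is 1 ([F_parity_twisted]).

  - The action on [X] is proximal ([twisted_act_proximal]).  Given [u] and [v],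
    the twist cancels in the product [z = u v], on which [F] acts by plain
    translation.  Any finite set of dyadics can be moved by some [h] in [F]
    into a set on which [z] is constant ([F_monochromatic]); then [h^-1 u] and
    [h^-1 v] agree up to a global sign on that finite set.  As the finite set
    grows, compactness yields a common limit.

  To find [h], first move the finite set into the positive integers: translate
  it to the right of [0] and then multiply by a power of 2 on a long interval
  ([F_to_integers]).  One of the two values of [z] is taken at infinitely many
  integers, and [F] can spread out the integers of a bounded interval until
  they all lie in this infinite set ([F_spread]).

  Signs are written as booleans with exclusive or, and a class of functions up
  to sign is represented by its unique member that vanishes at a base point
  [t0].  This makes [X] the full product of copies of [bool] indexed by the
  points other than [t0], compact by Tychonoff's theorem. *)

(** * Proximality in a product of copies of bool *)

Section BooleanConfigurations.
Variable I : eqType.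
Local Notation X := {ptws I -> bool}.

Lemma coordinate_cvgP (J : Type) (F : set_system J) (u : J -> X) (w : X) :
  Filter F -> (forall i, \forall j \near F, u j i = w i) -> u @ F --> w.
Proof.
move=> FF Fw; apply/cvg_sup => i U [_ [[B oB <-] Bw BU]].
apply: filterS (Fw i) => j /= uwi; apply: BU.
by move: Bw; rewrite /= -uwi.
Qed.

Lemma near_coordinate (w : X) i : \forall v \near w, v i = w i.
Proof.
exact: (@proj_continuous I (fun=> bool) i w [set b | b = w i] (discrete_set1 _)).
Qed.

Lemma near_coordinates (w : X) (s : seq I) :
  \forall v \near w, {in s, v =1 w}.
Proof.
elim: s => [|i s IHs]; first by apply: (@filterE _ (nbhs w)) => v j.
apply: filterS2 (near_coordinate w i) IHs => v vi vs j.
by rewrite inE => /predU1P[->//|/vs].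
Qed.

Lemma configurations_compact : compact [set: X].
Proof.
have := @tychonoff I (fun=> bool) (fun=> setT) (fun=> bool_compact).
by congr (@compact X _); apply/seteqP; split.
Qed.

Lemma configurations_hausdorff : hausdorff_space X.
Proof. by apply: hausdorff_product => ?; exact: discrete_hausdorff. Qed.

Lemma net_tails_filter (J : Type) (le : J -> J -> Prop) :
  directed_preorder le -> ProperFilter (net_tails le).
Proof.
move=> [[j0] le_refl le_trans le_dir]; apply: filter_from_proper.
  apply: filter_from_filter => [|i j _ _]; first by exists j0.
  have [k [ik jk]] := le_dir i j; exists k => // l /= kl.
  by split; exact: le_trans kl.
by move=> j _; exists j; exact: le_refl.
Qed.

(** Agreement of [act g x] and [act g y] on larger and larger finite sets gives
  only a net [h] along which the two orbits approach each other.  A cluster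
  point [w] of [act (h s) x] is a limit after reindexing: for each [s], some
  later index [r s] has [act (h (r s)) x] equal to [w] on [s], and [r s]
  contains [s], so that [act (h (r s)) y] also equals [w] there. *)
Lemma proximal_configurations (G : groupType) (act : G -> X -> X) :
    (forall (x y : X) (s : seq I), exists g, {in s, act g x =1 act g y}) ->
  proximal act.
Proof.
move=> agree x y.
pose le (s s' : seq I) := {subset s <= s'}.
have le_dir : directed_preorder le.
  split=> [|s|s1 s2 s3|s s'].
  - exact: inhabits [::].
  - by move=> i.
  - by move=> s12 s23 i /s12 /s23.
  - by exists (s ++ s'); split=> i si; rewrite mem_cat si ?orbT.
have PF := net_tails_filter le_dir.
have [h h_agree] := choice (agree x y).
have [w [_ w_cluster]] := configurations_compact
  (fmap_proper_filter (fun s => act (h s) x) PF) filterT.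
have near_w s : exists s', le s s' /\ {in s, act (h s') x =1 w}.
  have [|v [[s' ss' <-] vw]] := w_cluster
    [set act (h s') x | s' in le s] _ _ (near_coordinates w s).
    by exists s => // s' ss' /=; exists s'.
  by exists s'.
have [r r_near] := choice near_w.
exists (seq I), le, (h \o r), w; split => //.
  apply: coordinate_cvgP => i; exists [:: i] => // s /= si.
  by have [_ ->] := r_near s; last by apply: si; rewrite inE.
apply: coordinate_cvgP => i; exists [:: i] => // s /= si.
have {}si : i \in s by apply: si; rewrite inE.
by have [sr <-] := r_near s => //; rewrite h_agree //; exact: sr.
Qed.

End BooleanConfigurations.

(** * The action twisted by a cocycle, up to a global sign *)

Section TwistedAction.
Variables (G : groupType) (T : eqType) (t0 : T) (op : G -> T -> T).
Variable c : G -> T -> bool.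
Hypothesis op_action : group_action op.
Hypothesis c_cocycle : forall g h t, c (g * h)%g t = c g (op h t) (+) c h t.

Local Notation I := {t : T | t != t0}.
Local Notation X := {ptws I -> bool}.

(** The representative that vanishes at the base point. *)
Definition extend (x : X) (t : T) : bool := oapp x false (insub t).

Definition twist (g : G) (u : T -> bool) (t : T) : bool :=
  u (op g^-1 t)%g (+) c g (op g^-1 t)%g.

Definition twisted_act (g : discrete_topology G) (x : X) : X :=
  fun i => twist g (extend x) (val i) (+) twist g (extend x) t0.

Lemma extend_base x : extend x t0 = false.
Proof. by rewrite /extend insubF // eqxx. Qed.

Lemma extend_val x (i : I) : extend x (val i) = x i.
Proof. by rewrite /extend valK. Qed.

Lemma extend_twisted_act g x t :
  extend (twisted_act g x) t =
  twist g (extend x) t (+) twist g (extend x) t0.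
Proof.
have [->|tN0] := eqVneq t t0; first by rewrite extend_base addbb.
by rewrite -[t in LHS](SubK I tN0) extend_val.
Qed.

Lemma op_invK g t : op g (op g^-1 t)%g = t.
Proof. by case: op_action => op1 opM; rewrite -opM mulgV op1. Qed.

Lemma twist1 u : twist 1%g u =1 u.
Proof.
move=> t; have := c_cocycle 1 1 t; rewrite /twist; case: op_action => op1 _.
by rewrite mulg1 invg1 !op1; case: (c _ _) => //= _; rewrite addbF.
Qed.

Lemma twistM g h u : twist (g * h)%g u =1 twist g (twist h u).
Proof.
case: op_action => op1 opM t.
by rewrite /twist c_cocycle invgM !opM op_invK addbA addbAC.
Qed.

Lemma twisted_act_action : group_action twisted_act.
Proof.
split=> [x|g h x]; apply/funext => i.
  by rewrite /twisted_act !twist1 extend_base extend_val addbF.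
rewrite /twisted_act !twistM /twist !extend_twisted_act.
rewrite /twist. do 3!case: (extend _ _); do 5!case: (c _ _) => //.
Qed.

Lemma twisted_act_continuous :
  continuous_action (G := discrete_topology G) twisted_act.
Proof.
split; first exact: twisted_act_action.
have near_extend x t : \forall v \near x, extend v t = extend x t.
  rewrite /extend; case: insubP => [i _ _|_] /=; first exact: near_coordinate.
  exact: (@filterE _ (nbhs x)).
case=> g x; apply: coordinate_cvgP => i.
exists ([set g],
  [set v | extend v (op g^-1 (val i))%g = extend x (op g^-1 (val i))%g /\
           extend v (op g^-1 t0)%g = extend x (op g^-1 t0)%g]); last first.
  by move=> [_ v] [/= -> [vi v0]]; rewrite /twisted_act /twist vi v0.
split; first exact: discrete_set1.
exact: (@filterI _ (nbhs x) _ _ _ (near_extend x _) (near_extend x _)).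
Qed.

(** The hypothesis is a Ramsey property of the plain action [op].  It is used
  for the sum [z] of two configurations, in which [c] cancels; the base point
  is included in the finite set because normalisation at [t0] adds to each
  coordinate of the new configuration its value at [t0]. *)
Lemma twisted_act_proximal :
  (forall (z : T -> bool) (s : seq T),
    exists g b, {in s, forall t, z (op g t) = b}) ->
  proximal twisted_act.
Proof.
move=> mono; apply: proximal_configurations => x y s.
(* On this finite set, [g] makes [z] constant, so [g^-1] is what is wanted. *)
have [g [b gb]] := mono (fun t => extend x t (+) extend y t)
  (t0 :: map val s).
exists g^-1%g => i si; rewrite /twisted_act /twist invgK.
have := gb t0; rewrite mem_head => /(_ isT).
have := gb (val i); rewrite inE map_f ?orbT // => /(_ isT).
do 4!case: (extend _ _); do 2!case: (c _ _) => //; case: b gb => //.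
Qed.

(** At a fixed point, [c g] takes the same value at all points fixed by [g],
  namely the sign by which [g] multiplies the configuration. *)
Lemma twisted_act_no_fixed_point :
  (exists g s t, [/\ op g s = s, op g t = t & c g s != c g t]) ->
  ~ has_fixed_point twisted_act.
Proof.
move=> [g [s [t [gs gt cst]]]] [x /(_ g) gx].
have [op1 opM] := op_action.
have inv_fix r : op g r = r -> op g^-1%g r = r.
  by move=> {1}<-; rewrite -opM mulVg op1.
have := extend_twisted_act g x s; have := extend_twisted_act g x t.
rewrite gx /twist (inv_fix s) // (inv_fix t) //; move: cst.
do 3!case: (extend _ _); do 3!case: (c _ _) => //.
Qed.

End TwistedAction.

(** * Generators and induction in Thompson's group *)

Section Thompson.
Variable R : realType.
Implicit Types (x t : R) (f g h : homeo R).

Local Notation F := (generated_subgroup [set homeo_a R; homeo_b R]).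

Lemma homeo_mulgE f g t : (f * g)%g t = f (g t).
Proof. by []. Qed.

Lemma homeo_invgK g : cancel g (g^-1)%g.
Proof. exact: homeoK. Qed.

Lemma homeo_invgVK g : cancel (g^-1)%g g.
Proof. exact: homeoVK. Qed.

Lemma F_ind (H : set (homeo R)) :
  subgroup H -> H (homeo_a R) -> H (homeo_b R) -> F `<=` H.
Proof. by move=> HS Ha Hb g; apply; split => // _ [->|->]. Qed.

Lemma F1 : F 1%g.
Proof. by have [] := generated_subgroupP [set homeo_a R; homeo_b R]. Qed.

Lemma FM f g : F f -> F g -> F (f * g)%g.
Proof.
by have [_ H _] := generated_subgroupP [set homeo_a R; homeo_b R]; exact: H.
Qed.

Lemma FV f : F f -> F (f^-1)%g.
Proof.
by have [_ _ H] := generated_subgroupP [set homeo_a R; homeo_b R]; exact: H.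
Qed.

Lemma Fa : F (homeo_a R). Proof. by move=> H [_]; apply; left. Qed.

Lemma Fb : F (homeo_b R). Proof. by move=> H [_]; apply; right. Qed.

(** * The parity of the right slope *)

Definition right_exponent g t (k : int) :=
  exists2 e : R, 0 < e &
    forall s, 0 <= s <= e -> g (t + s) = g t + 2 ^ k * s.

Lemma right_exponent1 t : right_exponent 1%g t 0.
Proof. by exists 1 => // s _; rewrite mul1r. Qed.

Lemma right_exponentM f g t j k :
  right_exponent f (g t) j -> right_exponent g t k ->
  right_exponent (f * g)%g t (j + k).
Proof.
have p2 : 0 < 2 ^ k :> R by rewrite exprz_gt0.
move=> [e e0 fe] [d d0 gd]; exists (Num.min d (e / 2 ^ k)).
  by rewrite lt_min d0 divr_gt0.
move=> s /andP[s0]; rewrite le_min => /andP[sd]; rewrite ler_pdivlMr // => se.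
have ks : 0 <= 2 ^ k * s <= e by rewrite mulr_ge0 ?(ltW p2) //= mulrC.
by rewrite !homeo_mulgE gd ?s0 // fe // mulrA expfzDr.
Qed.

Lemma right_exponentV g t k :
  right_exponent g t k -> right_exponent (g^-1)%g (g t) (- k).
Proof.
have p2 : 0 < 2 ^ k :> R by rewrite exprz_gt0.
move=> [e e0 ge]; exists (2 ^ k * e); first exact: mulr_gt0.
move=> s /andP[s0 se]; rewrite -invr_expz.
have {1}-> : g t + s = g (t + (2 ^ k)^-1 * s).
  rewrite ge ?mulVKf ?(lt0r_neq0 p2) //.
  by rewrite ler_pdivrMl // se mulr_ge0 ?invr_ge0 ?(ltW p2).
by rewrite !homeo_invgK.
Qed.

Lemma right_exponent_uniq g t j k :
  right_exponent g t j -> right_exponent g t k -> j = k.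
Proof.
move=> [e e0 ge] [d d0 gd].
have m0 : 0 < Num.min e d by rewrite lt_min e0.
have := ge (Num.min e d); rewrite gd; last first.
  by rewrite ge_min lexx orbT ltW.
rewrite ge_min lexx ltW // => /(_ isT) /addrI /(mulIf (lt0r_neq0 m0)) /esym.
by apply: ieexprIz => //; rewrite ?ltr0n // pnatr_eq1.
Qed.

Lemma right_exponent_a t : right_exponent (homeo_a R) t 0.
Proof. by exists 1 => // s _ /=; rewrite /thompson_a expr0z; lra. Qed.

Lemma right_exponent_b_fixed t : t < 0 -> right_exponent (homeo_b R) t 0.
Proof.
move=> t0; exists (- t) => [|s /andP[s0 st]]; first lra.
by rewrite /= /thompson_b expr0z; repeat case: ifPn; rewrite -?ltNge => *; lra.
Qed.

Lemma right_exponent_b_halved t :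
  0 <= t < 2 -> right_exponent (homeo_b R) t (-1).
Proof.
move=> /andP[t0 t2]; exists (2 - t) => [|s /andP[s0 st]]; first lra.
rewrite /= /thompson_b exprN1.
by repeat case: ifPn; rewrite -?ltNge => *; lra.
Qed.

Lemma right_exponent_b_shifted t :
  2 <= t -> right_exponent (homeo_b R) t 0.
Proof.
move=> t2; exists 1 => // s /andP[s0 st].
by rewrite /= /thompson_b expr0z; repeat case: ifPn; rewrite -?ltNge => *; lra.
Qed.

Lemma right_exponent_exists g : F g -> forall t, exists k, right_exponent g t k.
Proof.
apply: (F_ind (H := [set g | forall t, exists k, right_exponent g t k])).
- split=> [t|f h fk hk t|f fk t]; first by exists 0; exact: right_exponent1.
    have [k tk] := hk t; have [j gj] := fk (h t).
    by exists (j + k); exact: right_exponentM.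
  have [k tk] := fk ((f^-1)%g t); exists (- k).
  by have := right_exponentV tk; rewrite homeo_invgVK.
- by move=> t; exists 0; exact: right_exponent_a.
move=> t; have [t0|t0] := ltP t 0.
  by exists 0; exact: right_exponent_b_fixed.
have [t2|t2] := ltP t 2.
  by exists (-1); apply: right_exponent_b_halved; rewrite t0.
by exists 0; exact: right_exponent_b_shifted.
Qed.

Definition slope_parity g t : bool := odd `|xget (0 : int) (right_exponent g t)|%N.

Lemma slope_parityE g t k : right_exponent g t k -> slope_parity g t = odd `|k|%N.
Proof.
move=> gk; rewrite /slope_parity; congr (odd (absz _)).
by apply: right_exponent_uniq (gk); apply: xgetPex; exists k.
Qed.

(** The chain rule; right slopes multiply because elements of [F] increase. *)
Lemma slope_parityM f g t : F f -> F g ->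
  slope_parity (f * g)%g t = slope_parity f (g t) (+) slope_parity g t.
Proof.
move=> /right_exponent_exists /(_ (g t))[j fj].
move=> /right_exponent_exists /(_ t)[k gk].
rewrite (slope_parityE fj) (slope_parityE gk).
rewrite (slope_parityE (right_exponentM fj gk)); lia.
Qed.

(** * Moving dyadic numbers to integers *)

Definition dyadic t := exists e (n : int), t * 2 ^+ e = n%:~R.

Lemma dyadicD1 t : dyadic (t + 1) <-> dyadic t.
Proof.
split=> -[e [n tn]]; [exists e, (n - 2 ^+ e)|exists e, (n + 2 ^+ e)].
  by rewrite rmorphB rmorphXn /= -tn; ring.
by rewrite rmorphD rmorphXn /= -tn; ring.
Qed.

Lemma dyadic_half t : dyadic (t / 2) <-> dyadic t.
Proof.
split=> -[e [n tn]].
  by exists e, (n * 2); rewrite rmorphM /= -tn; field.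
by exists e.+1, n; rewrite -tn exprS; field.
Qed.

Lemma dyadic_F g : F g -> forall t, dyadic (g t) <-> dyadic t.
Proof.
apply: (F_ind (H := [set g | forall t, dyadic (g t) <-> dyadic t])).
- split=> [//|f h fk hk t|f fk t]; first by rewrite homeo_mulgE fk.
  by rewrite -fk homeo_invgVK.
- by move=> t; rewrite -dyadicD1 [_ + 1]subrK.
move=> t /=; rewrite /thompson_b; case: ifP => // _; case: ifP => _.
  exact: dyadic_half.
by rewrite -dyadicD1 subrK.
Qed.

Lemma F_translation (n : nat) : exists2 h, F h & forall x, h x = x + n%:R.
Proof.
elim: n => [|n [h Fh hE]]; first by exists 1%g; [exact: F1|move=> x; rewrite addr0].
exists ((homeo_a R)^-1 * h)%g; first exact: FM (FV Fa) Fh.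
by move=> x; rewrite -natr1 addrA -hE.
Qed.

(** The conjugate of [b^-1] by the translation by [n]. *)
Lemma F_expand_unit (n : nat) : exists2 h, F h &
  [/\ forall x, x <= n%:R -> h x = x,
      forall x, n%:R <= x <= n%:R + 1 -> h x = n%:R + 2 * (x - n%:R) &
      forall x, n%:R + 1 <= x -> h x = x + 1].
Proof.
have [f Ff fE] := F_translation n.
exists (f * (homeo_b R)^-1 * f^-1)%g; first exact: FM (FM Ff (FV Fb)) (FV Ff).
have hE x : (f * (homeo_b R)^-1 * f^-1)%g x = thompson_b_inv (x - n%:R) + n%:R.
  rewrite -fE; congr (f (thompson_b_inv _)).
  by by apply: (can_inj (homeoK f)); rewrite homeo_invgVK fE subrK.
split=> x xn; rewrite hE /thompson_b_inv;
  repeat case: ifPn; rewrite -?ltNge => *; lra.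
Qed.

(** Once [0, n] has been doubled, the next unit interval [n, n + 1] has been
  moved to [2n, 2n + 1], where [F_expand_unit] doubles it and leaves the
  part already treated unchanged. *)
Lemma F_double (n : nat) : exists2 h, F h &
  (forall x, 0 <= x <= n%:R -> h x = 2 * x) /\
  (forall x, n%:R <= x -> h x = x + n%:R).
Proof.
elim: n => [|n [h Fh [h2 hn]]].
  by exists 1%g; [exact: F1|split=> x x0 /=; lra].
have [f Ff [f1 f2 f3]] := F_expand_unit (2 * n).
rewrite !natrM in f1 f2 f3.
exists (f * h)%g; first exact: FM.
split=> x; rewrite -natr1 homeo_mulgE => xn.
  have [xn'|xn'] := leP x n%:R; first by rewrite h2 ?f1; lra.
  by rewrite hn ?f2; lra.
by rewrite hn ?f3; lra.
Qed.

Lemma F_scale (n e : nat) : exists2 h, F h &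
  forall x, 0 <= x <= n%:R -> h x = x * 2 ^+ e.
Proof.
elim: e => [|e [h Fh hE]]; first by exists 1%g; [exact: F1|move=> x; rewrite mulr1].
have [f Ff [f2 _]] := F_double (n * 2 ^ e).
exists (f * h)%g => [|x xn]; first exact: FM.
rewrite homeo_mulgE hE // f2; first by rewrite exprS; ring.
case/andP: xn => x0 xn.
by rewrite natrM natrX mulr_ge0 ?exprn_ge0 //= ler_wpM2r ?exprn_ge0.
Qed.

Lemma dyadic_common_denominator (s : seq R) : {in s, forall t, dyadic t} ->
  exists e N : nat, {in s, forall t, `|t| < N%:R /\
    exists n : int, t * 2 ^+ e = n%:~R}.
Proof.
elim: s => [|t s IHs] ds; first by exists 0, 0.
have [|e [N sN]] := IHs; first by move=> u us; apply: ds; rewrite inE us orbT.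
have [d [m tm]] : dyadic t by apply: ds; rewrite mem_head.
exists (d + e)%N, (N + (Num.trunc `|t|).+1)%N => u.
rewrite inE => /predU1P[->|/sN[uN [n un]]]; split.
- rewrite natrD; apply: (lt_le_trans (y := (Num.trunc `|t|).+1%:R)).
    by rewrite truncnS_gt.
  by rewrite lerDr.
- by exists (m * 2 ^+ e); rewrite exprD mulrA tm rmorphM rmorphXn.
- by rewrite natrD ltr_wpDr.
by exists (n * 2 ^+ d); rewrite addnC exprD mulrA un rmorphM rmorphXn.
Qed.

(** After multiplication by a common denominator [2 ^ e] the numbers become
  integers; the preliminary translation is needed since [F_scale] only
  controls nonnegative numbers. *)
Lemma F_to_integers (s : seq R) : {in s, forall t, dyadic t} ->
  exists2 h, F h & exists K : nat, {in s, forall t,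
    exists2 i : nat, (0 < i <= K)%N & h t = i%:R}.
Proof.
move=> /dyadic_common_denominator[e [N sN]].
have [f Ff fE] := F_translation N.
have [h Fh hE] := F_scale (N + N) e.
exists (h * f)%g; first exact: FM.
(* [f] moves the numbers into [0, 2N], and [h] then multiplies by [2 ^ e]. *)
exists ((N + N) * 2 ^ e)%N => t /sN[/ltr_normlP[Nt tN] [n tn]].
rewrite homeo_mulgE hE fE ?natrD; last lra.
have p2 : 0 < 2 ^+ e :> R by rewrite exprn_gt0.
have nE : (t + N%:R) * 2 ^+ e = (n + N%:Z * 2 ^+ e)%:~R.
  by rewrite rmorphD rmorphM rmorphXn /= -tn mulrDl.
have n0 : 0 < n + N%:Z * 2 ^+ e.
  by rewrite -(ltr0z R) -nE mulr_gt0 //; lra.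
have nK : n + N%:Z * 2 ^+ e <= ((N + N) * 2 ^ e)%N%:Z.
  rewrite -(ler_int R) -nE -pmulrn natrM natrX natrD ler_pM2r //; lra.
exists (absz (n + N%:Z * 2 ^+ e)); first by lia.
by rewrite nE -{1}(gtz0_abs n0).
Qed.

(** * Moving integers into a monochromatic set *)

Lemma F_shift_beyond (n d : nat) : exists2 h, F h &
  (forall x, x <= n%:R -> h x = x) /\
  (forall x, n%:R + 1 <= x -> h x = x + d%:R).
Proof.
elim: d => [|d [h Fh [h1 h2]]].
  by exists 1%g; [exact: F1|split=> // x; rewrite addr0].
have [f Ff [f1 _ f3]] := F_expand_unit n.
exists (f * h)%g; first exact: FM.
split=> x xn; rewrite homeo_mulgE.
  by rewrite h1 ?f1.
rewrite h2 // f3 -?natr1 ?addrA //.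
by rewrite (le_trans xn) // lerDl.
Qed.

(** The integers [1, ..., k] are placed in [P] one after the other.  To place
  the next one, push everything beyond the images found so far to the right
  until it hits [P].  The integers still to be placed are only
  translated, by the shift [m], and this keeps the induction going. *)
Lemma F_spread (P : nat -> Prop) :
  (forall m, exists2 n, (m <= n)%N & P n) ->
  forall k, exists2 h, F h & exists m : nat, forall i : nat,
    ((0 < i <= k)%N -> exists2 j : nat, (j <= k + m)%N /\ P j & h i%:R = j%:R) /\
    ((k < i)%N -> h i%:R = (i + m)%:R).
Proof.
move=> Pinf; elim=> [|k [h Fh [m hm]]].
  exists 1%g; first exact: F1.
  by exists 0%N => i; split=> [|_]; [case: i|rewrite addn0].
have [p kp Pp] := Pinf (k + m).+1.
have [f Ff [f1 f2]] := F_shift_beyond (k + m) (p - (k + m).+1).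
exists (f * h)%g; first exact: FM.
exists (p - k.+1)%N => i; rewrite homeo_mulgE.
have [hle hgt] := hm i; split=> [/andP[i0]|ki]; last first.
  rewrite hgt 1?ltnW // f2; last by rewrite natr1 ler_nat; lia.
  by rewrite -natrD; congr (_%:R); lia.
rewrite leq_eqVlt => /predU1P[ik|ik].
  exists p; first by split => //; lia.
  rewrite hgt ?ik // f2; last by rewrite natr1 ler_nat; lia.
  by rewrite -natrD; congr (_%:R); lia.
have [|j [jk Pj] ->] := hle; first by rewrite i0.
by exists j; [split => //; lia|rewrite f1 // ler_nat].
Qed.

(** The pigeonhole principle for two colours. *)
Lemma infinite_color (z : nat -> bool) :
  exists b, forall m, exists2 n, (m <= n)%N & z n = b.
Proof.
have [zT|/existsNP[m mT]] := pselect (forall m, exists2 n, (m <= n)%N & z n).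
  by exists true.
exists false => m'; exists (maxn m m'); first exact: leq_maxr.
by apply/negbTE/negP => zm; apply: mT; exists (maxn m m'); first exact: leq_maxl.
Qed.

Lemma F_monochromatic (z : R -> bool) (s : seq R) :
  {in s, forall t, dyadic t} ->
  exists2 h, F h & exists b, {in s, forall t, z (h t) = b}.
Proof.
move=> /F_to_integers[f Ff [K fs]].
have [b zb] := infinite_color (fun n => z n%:R).
have [h Fh [m hm]] := F_spread zb K.
exists (h * f)%g; first exact: FM.
exists b => t /fs[i iK ti]; rewrite homeo_mulgE ti.
by have [/(_ iK)[j [_ zj] ->]] := hm i.
Qed.

(** * The action on dyadic numbers and the conclusion *)

Local Notation D := {t : R | `[< dyadic t >]}.

Lemma dyadic_F_act (g : thompsonF R) (t : D) : `[< dyadic (val g (val t)) >].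
Proof.
apply/asboolP/dyadic_F; first exact: set_mem (valP g).
exact/asboolP/(valP t).
Qed.

Definition F_act (g : thompsonF R) (t : D) : D :=
  exist _ (val g (val t)) (dyadic_F_act g t).

Definition F_parity (g : thompsonF R) (t : D) := slope_parity (val g) (val t).

Lemma F_act_action : group_action F_act.
Proof. by split=> [t|g h t]; apply: val_inj. Qed.

Lemma F_parity_cocycle (g h : thompsonF R) (t : D) :
  F_parity (g * h)%g t = F_parity g (F_act h t) (+) F_parity h t.
Proof. by apply: slope_parityM; exact: set_mem (valP _). Qed.

Lemma F_act_monochromatic (z : D -> bool) (s : seq D) :
  exists (g : thompsonF R) b, {in s, forall t : D, z (F_act g t) = b}.
Proof.
have [|h Fh [b hb]] := @F_monochromatic (oapp z false \o insub) (map val s).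
  by move=> _ /mapP[t _ ->]; exact/asboolP/(valP t).
exists (exist _ h (mem_set Fh)), b => t ts.
by rewrite -(hb (val t)) ?map_f //= (valK (F_act (exist _ h (mem_set Fh)) t)).
Qed.

Lemma F_parity_twisted : exists (g : thompsonF R) (s t : D),
  [/\ F_act g s = s, F_act g t = t & F_parity g s != F_parity g t].
Proof.
have d0 : `[< dyadic 0 >] by apply/asboolP; exists 0%N, 0; rewrite mul0r.
have d1 : `[< dyadic (-1) >] by apply/asboolP; exists 0%N, (-1); rewrite mulr1.
exists (exist _ (homeo_b R) (mem_set Fb)), (exist _ 0 d0), (exist _ (-1) d1); split.
- by apply: val_inj; rewrite /= /thompson_b lexx.
- by apply: val_inj; rewrite /= /thompson_b lerN10.
rewrite /F_parity /= (@slope_parityE _ _ (-1)) ?(@slope_parityE _ _ 0) //.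
  by apply: right_exponent_b_fixed; rewrite ltrN10.
by apply: right_exponent_b_halved; rewrite lexx ltr0n.
Qed.

End Thompson.

Theorem theorem2p5 (R : realType) :
  ~ strongly_amenable (discrete_topology (thompsonF R)) /\
  exists (X : topologicalType)
         (act : discrete_topology (thompsonF R) -> X -> X),
    [/\ [set: X] !=set0, compact [set: X] & hausdorff_space X] /\
    [/\ continuous_action act, proximal act &
        ~ exists x : X, forall f, act f x = x].
Proof.
have [_ [t0 _]] := F_parity_twisted R.
pose X : topologicalType := {ptws {t | t != t0} -> bool}.
pose act : discrete_topology (thompsonF R) -> X -> X :=
  twisted_act (@F_act R) (@F_parity R).
have X0 : [set: X] !=set0 by exists (fun=> false).
have Xc : compact [set: X] by exact: configurations_compact.
have Xh : hausdorff_space X by exact: configurations_hausdorff.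
have act_cont : continuous_action act.
  exact: (twisted_act_continuous t0 (@F_act_action R) (@F_parity_cocycle R)).
have act_prox : proximal act.
  exact: (twisted_act_proximal (t0 := t0) (F_parity (R := R)) (@F_act_monochromatic R)).
have act_free : ~ has_fixed_point act.
  exact: (twisted_act_no_fixed_point (@F_act_action R) (F_parity_twisted R)).
split; first by move=> /(_ X act X0 Xc Xh act_cont act_prox).
by exists X, act.
Qed.
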